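(* No algorithm can solve no-self-APSD enumeration on a weighted graph with both delay and preprocessing in $o(\Delta)$, even if the graph is connected and has constant average degree.
   Context: Input: a graph $G=(V,E)$ with non-negative integer edge weights, given as read-only adjacency lists; the algorithm can query vertex degrees and the next neighbor (together with the edge weight) in any adjacency list. $\Delta$ is the maximum (out-)degree. $d(u,v)$ is the shortest weighted distance ($\infty$ if unreachable). No-self-APSD enumeration: output each triple $(u,v,d(u,v))$ with $u\neq v$ exactly once. Preprocessing: time allowed before enumeration starts; delay: maximum time to the first output after preprocessing, between consecutive outputs, and until termination is signalled. *)

(* Defs.v *)
From mathcomp Require Import all_boot all_order all_algebra.
From mathcomp Require Import all_classical all_reals all_analysis.
Import GRing.Theory Num.Theory.
Import numFieldNormedType.Exports.

Set Implicit Arguments.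
Unset Strict Implicit.
Unset Printing Implicit Defensive.

Local Open Scope nat_scope.

(* Finite simple undirected graphs with edge weights in nat, as adjacency
   lists: (v, w) \in adj u means that {u, v} is an edge of weight w.  The order
   of the entries in each list is arbitrary. *)
Record wgraph := WGraph {
  nverts : nat;
  adj : 'I_nverts -> seq ('I_nverts * nat);
  adj_uniq : forall u, uniq (unzip1 (adj u));
  adj_irrefl : forall u, u \notin unzip1 (adj u);
  adj_sym : forall u v w, ((v, w) \in adj u) = ((u, w) \in adj v) }.

Section Graph.
Variable G : wgraph.
Local Notation V := 'I_(nverts G).

Definition edge : rel V := fun u v => v \in unzip1 (adj u).

Definition graph_connected : Prop :=
  (0 < nverts G) /\ (forall u v : V, connect edge u v).

Definition vdegree (u : V) : nat := size (adj u).

Definition max_degree : nat := \max_(u : V) vdegree u.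

Definition average_degree (R : realType) : R :=
  ((\sum_(u : V) vdegree u)%:R / (nverts G)%:R)%R.

(* A walk from u is the sequence of the pairs (next vertex, weight of the
   traversed edge); the weight 0 attached to the initial vertex is a dummy. *)
Definition is_walk (u v : V) (p : seq (V * nat)) : bool :=
  path (fun x y => y \in adj x.1) (u, 0) p && ((last (u, 0) p).1 == v).

Definition walk_weight (p : seq (V * nat)) : nat := sumn (unzip2 p).

(* None stands for the infinite distance. *)
Definition is_distance (u v : V) (d : option nat) : Prop :=
  match d with
  | Some k => (exists2 p, is_walk u v p & walk_weight p = k) /\
              (forall p, is_walk u v p -> k <= walk_weight p)
  | None => forall p, ~~ is_walk u v p
  end.

End Graph.

(* The APSD triples (u, v, d(u, v)) over n vertices. *)
Definition triple (n : nat) := ('I_n * 'I_n * option nat)%type.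

Inductive instr (n : nat) (S : Type) : Type :=
| Compute of S
| GetDegree of 'I_n & (nat -> S)
| NextNeighbor of 'I_n & (option ('I_n * nat) -> S)
| Output of triple n & S
| Halt.
Arguments Halt {n S}.

(* The state type is arbitrary: memory and the choice of the next instruction
   are free, every instruction costs one unit of time, and the graph can only
   be accessed through the two queries. *)
Record machine (n : nat) := Machine {
  state : Type;
  start : state;
  exec : state -> instr n state }.

(* The number of vertices is known in advance. *)
Definition algorithm := forall n : nat, machine n.

Section Run.
Variables (G : wgraph) (M : machine (nverts G)).
Local Notation V := 'I_(nverts G).

(* A machine state with, for each adjacency list, the number of entries
   already read. *)
Definition config := (state M * (V -> nat))%type.

(* A query to an exhausted list is answered by None. *)
Definition next_config (c : config) : config :=
  let: (s, pos) := c in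
  match exec s with
  | Compute s' => (s', pos)
  | GetDegree v k => (k (vdegree v), pos)
  | NextNeighbor v k =>
      (k (onth (adj v) (pos v)), fun u => if u == v then (pos v).+1 else pos u)
  | Output _ s' => (s', pos)
  | Halt => c
  end.

Definition config_at (t : nat) : config :=
  iter t next_config (start M, fun=> 0).

(* Instruction number t, counted from 0, takes the time from t to t.+1. *)
Definition instr_at (t : nat) : instr (nverts G) (state M) :=
  exec (config_at t).1.

Definition output_at (t : nat) : option (triple (nverts G)) :=
  if instr_at t is Output x _ then Some x else None.

Definition output_times (T : nat) : seq nat :=
  [seq t <- iota 0 T | isSome (output_at t)].

Definition outputs (T : nat) : seq (triple (nverts G)) :=
  pmap output_at (iota 0 T).

(* On input G, M halts after having output each no-self-APSD triple exactly
   once; enumeration starts at time p, and consecutive events among the start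
   of the enumeration, the outputs and the termination (at time T.+1) are at
   most d apart. *)
Definition enumerates_apsd (p d : nat) : Prop :=
  exists T : nat,
    [/\ instr_at T = Halt,
        uniq (outputs T),
        (forall (u v : V) (x : option nat),
          (u, v, x) \in outputs T <-> u != v /\ is_distance u v x),
        all (leq p) (rcons (output_times T) T) &
        path (fun s t => t - s <= d) p
          [seq t.+1 | t <- rcons (output_times T) T]].

End Run.

(* The filter of the graphs of the class C with maximum degree tending to
   infinity. *)
Definition max_degree_oo (C : set wgraph) : set_system wgraph :=
  filter_from [set: nat] (fun D => [set G | C G /\ D <= max_degree G])%classic.

#[global] Instance max_degree_oo_filter (C : set wgraph) :
  Filter (max_degree_oo C).
Proof.
apply: filter_fromT_filter; first by exists 0.
move=> i j; exists (maxn i j) => G [CG]; rewrite geq_max => /andP[iG jG].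
by split; split.
Qed.

Canonical max_degree_oo_filter_on (C : set wgraph) :=
  FilterType (max_degree_oo C) (max_degree_oo_filter C).

(* t(G) = o(Delta(G)) over the graphs G of the class C. *)
Definition o_max_degree (R : realType) (C : set wgraph) (t : wgraph -> nat) :
    Prop :=
  (fun G : wgraph => (t G)%:R%R : R^o) =o_ (max_degree_oo C)
  (fun G : wgraph => (max_degree G)%:R%R : R^o).

Definition sparse_connected (R : realType) (c : R) : set wgraph :=
  [set G | graph_connected G /\ (average_degree G R <= c)%R]%classic.

(* Main.v *)
(* An adversary argument. The input is a clique on D = 4t vertices followed by a
   path on the remaining vertices, with at least D^2 vertices in all, so that
   the average degree is at most 3. As long as fewer than t instructions have
   been executed, the adversary answers every degree query by D - 1 and every
   neighbour query by one of t + 1 fixed vertices, with weight 1; it decides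
   afterwards that the vertices seen so far belong to the clique. Both the graph
   with all weights 1 and the graph where the edges at one unseen clique vertex
   have weight 0 are consistent with these answers, but no two distinct vertices
   seen so far have the same distance in both. Hence nothing correct can be
   output in the first t instructions, while preprocessing and delay in
   o(Delta) would force an output. *)
Require Import Defs.
From mathcomp Require Import all_boot all_order all_algebra.
From mathcomp Require Import all_classical all_reals all_analysis.
From mathcomp Require Import zify.

Set Implicit Arguments.
Unset Strict Implicit.
Unset Printing Implicit Defensive.

Import GRing.Theory Num.Theory.
Local Open Scope nat_scope.

(** Transfers counts and sums over the vertices listed in [s] to their positions. *)
Lemma map_index_uniq (T : eqType) (s : seq T) :
  uniq s -> [seq index x s | x <- s] = iota 0 (size s).
Proof.
case: s => [//|x0 s' us]; set s := x0 :: s'.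
apply: (@eq_from_nth _ 0); rewrite ?size_map ?size_iota // => i ilt.
by rewrite (nth_map x0) // nth_iota // index_uniq.
Qed.

(** * Degrees in the lollipop on positions *)

Definition lollipop (D i j : nat) : bool :=
  (i != j) && [|| (i < D) && (j < D), i.+1 == j | j.+1 == i].

Lemma lollipop_sym D : symmetric (lollipop D).
Proof. by move=> i j; rewrite /lollipop; apply/idP/idP; lia. Qed.

Definition lollipop_degree (D n i : nat) : nat :=
  count (lollipop D i) (iota 0 n).

Lemma count_ltn_iota D n : count (fun j => j < D) (iota 0 n) <= D.
Proof.
by rewrite -size_filter -[leqRHS](size_iota 0); apply: uniq_leq_size;
  [rewrite filter_uniq ?iota_uniq | move=> j; rewrite mem_filter !mem_iota; lia].
Qed.

Lemma lollipop_degree_le D n i :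
  lollipop_degree D n i <= (i < D) * D + 2.
Proof.
pose a j := (i < D) && (j < D).
apply: (@leq_trans (count (predU a (predU (pred1 i.+1) (pred1 i.-1)))
  (iota 0 n))).
  by apply: sub_count => j; rewrite /lollipop /a /=; lia.
have cU (b c : pred nat) r : count (predU b c) r <= count b r + count c r.
  by rewrite -count_predUI leq_addr.
have c1 k : count_mem k (iota 0 n) <= 1.
  by rewrite count_uniq_mem ?iota_uniq // leq_b1.
have ca : count a (iota 0 n) <= (i < D) * D.
  rewrite /a; case: (i < D) => /=; last by rewrite count_pred0.
  by rewrite mul1n count_ltn_iota.
apply: (leq_trans (cU _ _ _)); apply: leq_add => //.
exact: leq_trans (cU _ _ _) (leq_add (c1 _) (c1 _)).
Qed.

(** The last clique position is excluded: the path leaves from there and may add one neighbour. *)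
Lemma lollipop_degree_clique D n i :
  i.+1 < D -> D <= n -> lollipop_degree D n i = D.-1.
Proof.
move=> iD Dn; rewrite /lollipop_degree -(subnKC Dn) iotaD count_cat add0n.
rewrite [X in _ + X](_ : _ = 0); last first.
  apply/eqP; rewrite -leqn0 leqNgt -has_count; apply/hasPn => j.
  by rewrite mem_iota /lollipop; lia.
rewrite addn0 (@eq_in_count _ _ (predC (pred1 i))); last first.
  by move=> j; rewrite mem_iota /lollipop /=; lia.
have := count_predC (pred1 i) (iota 0 D).
by rewrite count_uniq_mem ?iota_uniq // mem_iota size_iota; lia.
Qed.

(** The clique contributes at most [D * D <= n], the path at most two neighbours per position. *)
Lemma sum_lollipop_degree D n :
  D * D <= n -> \sum_(0 <= i < n) lollipop_degree D n i <= 3 * n.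
Proof.
move=> Dn; apply: (@leq_trans (\sum_(0 <= i < n) ((i < D) * D + 2))).
  by apply: leq_sum => i _; apply: lollipop_degree_le.
rewrite big_split /= -big_distrl /= sum_nat_const_nat.
rewrite [X in X * D](_ : _ = count (fun j => j < D) (iota 0 n)); last first.
  rewrite -sum1_count [RHS]big_mkcond /index_iota subn0.
  by apply: eq_bigr => i _; case: (i < D).
by have := count_ltn_iota D n; nia.
Qed.

(** * Lollipop graphs along a vertex order *)

Section LollipopGraph.
Variables (n D : nat) (s : seq 'I_n) (wt : 'I_n -> 'I_n -> nat).
Hypotheses (us : uniq s) (ms : forall x, x \in s).
Hypothesis wt_sym : forall x y, wt x y = wt y x.

(** Filtering [s] also orders each adjacency list by [s], so the choice of [s] controls which
    neighbours are read first. *)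
Definition lolli_nbrs (v : 'I_n) : seq 'I_n :=
  [seq x <- s | lollipop D (index v s) (index x s)].

Definition lolli_adj (v : 'I_n) : seq ('I_n * nat) :=
  [seq (x, wt v x) | x <- lolli_nbrs v].

Lemma unzip1_lolli_adj v : unzip1 (lolli_adj v) = lolli_nbrs v.
Proof. by rewrite /unzip1 -map_comp map_id. Qed.

Lemma mem_lolli_nbrs u v :
  (v \in lolli_nbrs u) = lollipop D (index u s) (index v s).
Proof. by rewrite mem_filter ms andbT. Qed.

Lemma mem_lolli_adj u v w :
  ((v, w) \in lolli_adj u) =
  lollipop D (index u s) (index v s) && (w == wt u v).
Proof.
apply/mapP/andP => [[x]|[uv /eqP->]].
  by rewrite mem_lolli_nbrs => ux [-> ->].
by exists v; rewrite ?mem_lolli_nbrs.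
Qed.

Lemma lolli_adj_uniq u : uniq (unzip1 (lolli_adj u)).
Proof. by rewrite unzip1_lolli_adj filter_uniq. Qed.

Lemma lolli_adj_irrefl u : u \notin unzip1 (lolli_adj u).
Proof. by rewrite unzip1_lolli_adj mem_lolli_nbrs /lollipop eqxx. Qed.

Lemma lolli_adj_sym u v w :
  ((v, w) \in lolli_adj u) = ((u, w) \in lolli_adj v).
Proof. by rewrite !mem_lolli_adj lollipop_sym wt_sym. Qed.

Definition lolli_graph : wgraph :=
  WGraph lolli_adj_uniq lolli_adj_irrefl lolli_adj_sym.

Lemma size_lolli_order : size s = n.
Proof.
rewrite -[RHS]card_ord -(card_uniqP us); apply: eq_card => x.
by rewrite ms inE.
Qed.

Lemma lolli_vdegree u :
  @vdegree lolli_graph u = lollipop_degree D n (index u s).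
Proof.
rewrite /vdegree /= size_map size_filter /lollipop_degree.
rewrite -[X in iota 0 X]size_lolli_order.
by rewrite -map_index_uniq // count_map.
Qed.

Lemma lolli_max_degree_le : max_degree lolli_graph <= D + 2.
Proof.
apply/bigmax_leqP => u _; rewrite lolli_vdegree.
by apply: leq_trans (lollipop_degree_le _ _ _) _; case: (_ < D); lia.
Qed.

Lemma lolli_max_degree_ge :
  1 < D -> D <= n -> D.-1 <= max_degree lolli_graph.
Proof.
move=> D1 Dn; have n0 : 0 < n by lia.
pose u : 'I_n := nth (Ordinal n0) s 0.
have iu : index u s = 0 by rewrite index_uniq // size_lolli_order.
by rewrite -(lollipop_degree_clique D1 Dn) -iu -lolli_vdegree;
   apply: (@leq_bigmax _ (@vdegree lolli_graph) u).
Qed.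

Lemma lolli_average_degree (R : realType) :
  D * D <= n -> (average_degree lolli_graph R <= 3%:R)%R.
Proof.
move=> Dn; rewrite /average_degree.
have [n0|n0] := posnP n.
  by rewrite /= [X in (_ / X%:R)%R]n0 invr0 mulr0 ler0n.
rewrite ler_pdivrMr ?ltr0n // -natrM ler_nat.
rewrite (eq_bigr _ (fun u _ => lolli_vdegree u)).
apply: leq_trans (sum_lollipop_degree Dn).
rewrite /index_iota subn0.
rewrite -[X in iota 0 X]size_lolli_order -map_index_uniq // big_map.
rewrite (perm_big s) //; apply: uniq_perm => //.
  exact: index_enum_uniq.
by move=> x; rewrite ms mem_index_enum.
Qed.

Lemma lolli_connected : 0 < n -> graph_connected lolli_graph.
Proof.
move=> n0; split=> // u v.
have edgeE x y : @edge lolli_graph x y = lollipop D (index x s) (index y s).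
  by rewrite /edge /= unzip1_lolli_adj mem_lolli_nbrs.
have esym : connect_sym (@edge lolli_graph).
  by apply: sym_connect_sym => x y; rewrite !edgeE lollipop_sym.
pose x i := nth (Ordinal n0) s i.
have from0 i : i < n -> connect (@edge lolli_graph) (x 0) (x i).
  elim: i => [|i IH] lti; first exact: connect0.
  apply: connect_trans (IH (ltnW lti)) _; apply: connect1.
  rewrite edgeE /x !index_uniq ?size_lolli_order ?(ltnW lti) //.
  by rewrite /lollipop; lia.
have xE w : x (index w s) = w by exact: nth_index.
have lt_index w : index w s < n by rewrite -[ltnRHS]size_lolli_order index_mem.
by apply: (@connect_trans _ _ (x 0)); rewrite ?[connect _ u _]esym;
  [rewrite -[u]xE | rewrite -[v]xE]; apply: from0; apply: lt_index.
Qed.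

End LollipopGraph.

(** * Runs against an oracle *)

Section OracleRun.
Variables (n : nat) (M : machine n).
Variables (deg : 'I_n -> nat) (nbr : 'I_n -> nat -> option ('I_n * nat)).

(* [next_config] with the answers to the queries given by [deg] and [nbr], which
   need not come from a graph. *)
Definition oracle_next (c : state M * ('I_n -> nat)) : state M * ('I_n -> nat) :=
  let: (s, pos) := c in
  match exec s with
  | Compute s' => (s', pos)
  | GetDegree v k => (k (deg v), pos)
  | NextNeighbor v k =>
      (k (nbr v (pos v)), fun u => if u == v then (pos v).+1 else pos u)
  | Output _ s' => (s', pos)
  | Halt => c
  end.

Definition oracle_at (t : nat) : state M * ('I_n -> nat) :=
  iter t oracle_next (start M, fun=> 0).

(** Outputs count as well, so that vertices output without ever being queried are later placed in
    the clique too. *)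
Definition touched_by (i : instr n (state M)) : seq 'I_n :=
  match i with
  | GetDegree v _ => [:: v]
  | NextNeighbor v _ => [:: v]
  | Output (u, v, _) _ => [:: u; v]
  | _ => [::]
  end.

Definition oracle_touched (t : nat) : seq 'I_n :=
  flatten [seq touched_by (exec (oracle_at i).1) | i <- iota 0 t].

Lemma mem_oracle_touched t i x :
  i < t -> x \in touched_by (exec (oracle_at i).1) -> x \in oracle_touched t.
Proof.
move=> it xi; apply/flattenP; exists (touched_by (exec (oracle_at i).1)) => //.
by apply: map_f; rewrite mem_iota.
Qed.

Lemma size_oracle_touched t : size (oracle_touched t) <= 2 * t.
Proof.
rewrite size_flatten /shape -map_comp sumnE big_map.
apply: (@leq_trans (\sum_(i <- iota 0 t) 2)).
  by apply: leq_sum => i _ /=; case: (exec _) => //= -[[u v] d] _.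
by rewrite big_const_seq count_predT size_iota iter_addn_0.
Qed.

(** Each instruction advances at most one list, by one entry; hence [t] instructions only request
    entries of index below [t]. *)
Lemma oracle_pos_le t v : (oracle_at t).2 v <= t.
Proof.
elim: t v => [//|t IH] v; rewrite /oracle_at iterS -/(oracle_at t).
move: IH; case: (oracle_at t) => s pos /= IH; move: (IH v) => IHv.
case: (exec s) => [s'|u k|u k|x s'|] //=; try exact: leqW.
by case: ifP => _; [rewrite ltnS; apply: IH | exact: leqW].
Qed.

End OracleRun.

(** Induction on time: each query concerns a touched vertex and, by [oracle_pos_le], an entry on
    which graph and oracle agree. *)
Lemma config_at_oracle (G : wgraph) (M : machine (nverts G))
    (deg : 'I_(nverts G) -> nat)
    (nbr : 'I_(nverts G) -> nat -> option ('I_(nverts G) * nat)) (t : nat) :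
  (forall v, v \in oracle_touched M deg nbr t -> vdegree v = deg v) ->
  (forall v i, v \in oracle_touched M deg nbr t -> i < t ->
    onth (adj v) i = nbr v i) ->
  forall i, i <= t -> config_at M i = oracle_at M deg nbr i.
Proof.
move=> hdeg hnbr; elim=> [//|i IH] it.
rewrite /config_at iterS -/(config_at M i) IH ?(ltnW it) //.
rewrite /oracle_at iterS -/(oracle_at M deg nbr i).
have := @mem_oracle_touched _ M deg nbr _ _ ^~ it.
have := oracle_pos_le M deg nbr i.
case: (oracle_at M deg nbr i) => s pos /= pos_le.
case: (exec s) => [s'|v k|v k|x s'|] //= tch.
  by rewrite hdeg // tch ?mem_head.
by rewrite hnbr ?tch ?mem_head // (leq_ltn_trans (pos_le v)).
Qed.

(** * Consequences of a correct enumeration *)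

Section Enumeration.
Variables (G : wgraph) (M : machine (nverts G)) (p d : nat).
Hypothesis enumM : enumerates_apsd M p d.

Lemma instr_at_halted T t : instr_at M T = Halt -> T <= t -> instr_at M t = Halt.
Proof.
move=> haltT /subnKC <-; elim: (t - T) => [|k IH]; rewrite ?addn0 //.
rewrite addnS; move: IH; rewrite /instr_at /config_at iterS.
rewrite -/(config_at M (T + k)).
by case: (config_at M (T + k)) => s pos /= hs; rewrite hs /= hs.
Qed.

(** Correctness is specified for outputs before [T]; from [T] on the machine stays halted, so there
    are no others. *)
Lemma enumerates_output_correct t u v x :
  output_at M t = Some (u, v, x) -> u != v /\ @is_distance G u v x.
Proof.
case: enumM => T [haltT _ correct _ _] out_t; apply/correct.
rewrite /outputs mem_pmap; apply/mapP; exists t => //.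
rewrite mem_iota /= add0n ltnNge; apply/negP => Tt.
by move: out_t; rewrite /output_at (instr_at_halted haltT Tt).
Qed.

Lemma enumerates_first_output u v x :
  u != v -> @is_distance G u v x ->
  exists t, t < p + d /\ exists y, output_at M t = Some y.
Proof.
case: enumM => T [_ _ correct _ delays] uv uvx.
have : (u, v, x) \in outputs M T by apply/correct.
rewrite /outputs mem_pmap => /mapP[t0 t0T out_t0].
have : t0 \in output_times M T by rewrite mem_filter -out_t0.
have outputs_times t : t \in output_times M T -> isSome (output_at M t).
  by rewrite mem_filter => /andP[].
case: (output_times M T) delays outputs_times => [//|t s] /= /andP[td _] st _.
(* The output at [t] is complete at [t.+1], so the delay bound reads [t.+1 - p <= d], whence the
   strict inequality. *)
exists t; split; first by lia.
by have := st t (mem_head _ _); case: output_at => // y _; exists y.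
Qed.

End Enumeration.

(** * The vertex order chosen by the adversary *)

Section Adversary.
Variables (n t : nat) (M : machine n).
Local Notation D := (4 * t).
Hypotheses (t_gt2 : 2 < t) (D2n : D * D <= n).

(** One vertex to spare: a queried vertex may itself be a decoy, and [t] others must remain. *)
Definition decoy : seq 'I_n := take t.+1 (enum 'I_n).

Definition decoy_nbr (v : 'I_n) (i : nat) : option ('I_n * nat) :=
  onth [seq (x, 1) | x <- [seq x <- decoy | x != v]] i.

Definition decoy_touched : seq 'I_n :=
  oracle_touched M (fun=> D.-1) decoy_nbr t.

(** Decoys come first, so that the adjacency lists of revealed vertices begin with them. *)
Definition revealed : seq 'I_n :=
  decoy ++ undup [seq x <- decoy_touched | x \notin decoy].

Definition adv_order : seq 'I_n :=
  revealed ++ [seq x <- enum 'I_n | x \notin revealed].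

Lemma revealed_uniq : uniq revealed.
Proof.
rewrite cat_uniq take_uniq ?enum_uniq // undup_uniq andbT.
by apply/hasPn => x; rewrite mem_undup mem_filter => /andP[].
Qed.

Lemma adv_order_uniq : uniq adv_order.
Proof.
rewrite cat_uniq revealed_uniq filter_uniq ?enum_uniq // andbT.
by apply/hasPn => x; rewrite mem_filter => /andP[].
Qed.

Lemma mem_adv_order x : x \in adv_order.
Proof. by rewrite mem_cat mem_filter mem_enum andbT orbN. Qed.

Lemma touched_revealed x : x \in decoy_touched -> x \in revealed.
Proof.
by move=> xt; rewrite mem_cat mem_undup mem_filter xt andbT orbN.
Qed.

Lemma size_decoy : size decoy = t.+1.
Proof. by rewrite size_takel // size_enum_ord; nia. Qed.

(** There are at most [t.+1 + 2 * t] revealed vertices, fewer than [4 * t - 1] since [t > 2]; the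
    last clique position stays free. *)
Lemma size_revealed : size revealed < D.-1.
Proof.
have touched_le : size decoy_touched <= 2 * t := size_oracle_touched _ _ _ _.
rewrite size_cat size_decoy; apply: (@leq_ltn_trans (t.+1 + 2 * t)).
  rewrite leq_add2l; apply: leq_trans (size_undup _) _.
  by rewrite size_filter (leq_trans (count_size _ _)).
by move: t_gt2; lia.
Qed.

Lemma n_gt0 : 0 < n. Proof. by move: D2n t_gt2; nia. Qed.

(** Last clique position: past all revealed vertices, yet adjacent to each of them. *)
Definition hub : 'I_n := nth (Ordinal n_gt0) adv_order D.-1.

Lemma index_hub : index hub adv_order = D.-1.
Proof.
rewrite index_uniq ?adv_order_uniq //.
by rewrite (size_lolli_order adv_order_uniq mem_adv_order);
  move: D2n t_gt2; nia.
Qed.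

Lemma index_revealed x : x \in revealed -> index x adv_order < D.-1.
Proof.
move=> xr; rewrite index_cat xr.
by apply: ltn_trans size_revealed; rewrite index_mem.
Qed.

Lemma revealed_neq_hub x : x \in revealed -> x != hub.
Proof.
move=> /index_revealed; apply: contraL => /eqP->.
by rewrite index_hub ltnn.
Qed.

(** * Weightings indistinguishable during the first [t] instructions *)

Section Weights.
Variable wt : 'I_n -> 'I_n -> nat.
Hypothesis wt_sym : forall x y, wt x y = wt y x.
Hypothesis wt_revealed : {in revealed &, forall x y, wt x y = 1}.

Let G := lolli_graph D adv_order_uniq mem_adv_order wt_sym.

Lemma lollipop_clique u v :
  index u adv_order < D -> index v adv_order < D ->
  lollipop D (index u adv_order) (index v adv_order) = (u != v).
Proof.
move=> uD vD; rewrite /lollipop uD vD /= andbT.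
by rewrite (inj_in_eq (@index_inj _ u adv_order)) ?mem_adv_order.
Qed.

Lemma adv_onth v i : v \in revealed -> i < t ->
  onth (@adj G v) i = decoy_nbr v i.
Proof.
move=> vr it; rewrite /decoy_nbr /= /lolli_adj /lolli_nbrs.
set s := adv_order; rewrite {3}/s /adv_order /revealed -catA filter_cat map_cat.
have lt_D x : x \in revealed -> index x adv_order < D.
  by move=> /index_revealed; lia.
have -> : [seq x <- decoy | lollipop D (index v s) (index x s)] =
          [seq x <- decoy | x != v].
  apply: eq_in_filter => x xd.
  by rewrite lollipop_clique 1?eq_sym ?lt_D // mem_cat xd.
have -> : [seq (x, wt v x) | x <- [seq x <- decoy | x != v]] =
          [seq (x, 1) | x <- [seq x <- decoy | x != v]].
  apply/eq_in_map => x; rewrite mem_filter => /andP[_ xd].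
  by rewrite wt_revealed // mem_cat xd.
(* Removing [v] leaves at least [t] decoys, so the index [i < t] falls inside this first block. *)
rewrite onth_cat size_map ifT // size_filter.
have := count_predC (pred1 v) decoy.
rewrite count_uniq_mem ?take_uniq ?enum_uniq // size_decoy.
rewrite (@eq_count _ (predC (pred1 v)) (fun x => x != v)) //.
by move: it; case: (v \in decoy) => /=; lia.
Qed.

Lemma adv_config_at i : i <= t ->
  @config_at G M i = oracle_at M (fun=> D.-1) decoy_nbr i.
Proof.
apply: config_at_oracle => [v vt|v j vt jt].
  rewrite lolli_vdegree lollipop_degree_clique //.
    by rewrite -ltn_predRL; apply: index_revealed (touched_revealed vt).
  by move: D2n t_gt2; nia.
exact: adv_onth (touched_revealed vt) jt.
Qed.

Lemma adv_output_at i : i < t ->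
  @output_at G M i =
  if exec (oracle_at M (fun=> D.-1) decoy_nbr i).1 is Output x _
  then Some x else None.
Proof. by move=> it; rewrite /output_at /instr_at adv_config_at // ltnW. Qed.

Lemma adv_output_revealed i u v x : i < t ->
  @output_at G M i = Some (u, v, x) -> u \in revealed /\ v \in revealed.
Proof.
move=> it; rewrite adv_output_at //.
have := @mem_oracle_touched _ M (fun=> D.-1) decoy_nbr _ _ ^~ it.
case: (exec _) => //= y _ tch [yE]; rewrite yE in tch.
by split; apply: touched_revealed; apply: tch; rewrite !inE eqxx ?orbT.
Qed.

Lemma adv_mem_adj u v : index u adv_order < D -> index v adv_order < D ->
  u != v -> (v, wt u v) \in @adj G u.
Proof.
move=> uD vD uv; rewrite /= mem_lolli_adj; last exact: mem_adv_order.
by rewrite lollipop_clique // eqxx andbT.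
Qed.

End Weights.

(** * The two weightings and their distances *)

Definition unit_weight (x y : 'I_n) : nat := 1.

Definition hub_weight (x y : 'I_n) : nat := (x != hub) && (y != hub).

Lemma unit_weight_sym x y : unit_weight x y = unit_weight y x.
Proof. by []. Qed.

Lemma hub_weight_sym x y : hub_weight x y = hub_weight y x.
Proof. by rewrite /hub_weight andbC. Qed.

Lemma unit_weight_revealed : {in revealed &, forall x y, unit_weight x y = 1}.
Proof. by []. Qed.

Lemma hub_weight_revealed : {in revealed &, forall x y, hub_weight x y = 1}.
Proof. by move=> x y xr yr; rewrite /hub_weight !revealed_neq_hub. Qed.

Definition unit_graph : wgraph :=
  lolli_graph D adv_order_uniq mem_adv_order unit_weight_sym.

Definition hub_graph : wgraph :=
  lolli_graph D adv_order_uniq mem_adv_order hub_weight_sym.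

(** A walk between distinct vertices is nonempty, and its first edge already weighs 1. *)
Lemma unit_graph_walk_gt0 u v p :
  @is_walk unit_graph u v p -> u != v -> 0 < walk_weight p.
Proof.
case: p => [|[x w] p] /andP[/= walk]; first by move=> /eqP->; rewrite eqxx.
move: walk => /andP[]; rewrite mem_lolli_adj; last exact: mem_adv_order.
by move=> /andP[_ /eqP->].
Qed.

(** The detour through [hub] uses two clique edges of weight 0. *)
Lemma hub_graph_walk0 u v : u \in revealed -> v \in revealed ->
  exists2 p, @is_walk hub_graph u v p & walk_weight p = 0.
Proof.
move=> ur vr; exists [:: (hub, hub_weight u hub); (v, hub_weight hub v)].
  rewrite /is_walk /= eqxx andbT andbT.
  have hubD : index hub adv_order < D by rewrite index_hub; lia.
  have D_r x : x \in revealed -> index x adv_order < D.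
    by move=> /index_revealed; lia.
  have uh := adv_mem_adj hub_weight_sym (D_r _ ur) hubD (revealed_neq_hub ur).
  have vh : hub != v by rewrite eq_sym revealed_neq_hub.
  have hv := adv_mem_adj hub_weight_sym hubD (D_r _ vr) vh.
  by apply/andP; split; [exact: uh | exact: hv].
by rewrite /walk_weight /= /hub_weight eqxx andbF.
Qed.

Lemma adversary_wins p d p' d' :
  p + d <= t -> @enumerates_apsd unit_graph M p d ->
  ~ @enumerates_apsd hub_graph M p' d'.
Proof.
move=> pdt enum0 enum1.
(* The pair [x0], [hub] serves to show that some triple is due, so that a first output exists. *)
have [x0 x0r] : exists x, x \in revealed.
  exists (nth hub decoy 0).
  by rewrite mem_cat mem_nth // size_decoy.
have x0D : index x0 adv_order < D by have := index_revealed x0r; lia.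
have hubD : index hub adv_order < D by rewrite index_hub; lia.
have x0_hub := revealed_neq_hub x0r.
have dist0 : @is_distance unit_graph x0 hub (Some 1).
  split=> [|q walk]; last exact: unit_graph_walk_gt0 walk x0_hub.
  exists [:: (hub, 1)] => //; rewrite /is_walk /= eqxx !andbT.
  exact: (adv_mem_adj unit_weight_sym).
have [i [ipd [[[u v] x] out0]]] := enumerates_first_output enum0 x0_hub dist0.
have it : i < t by exact: leq_trans pdt.
have [ur vr] := adv_output_revealed unit_weight_revealed it out0.
have out1 : @output_at hub_graph M i = Some (u, v, x).
  by rewrite -out0 !adv_output_at //; exact: hub_weight_revealed.
have [uv dist_u] := enumerates_output_correct enum0 out0.
have [_ dist_h] := enumerates_output_correct enum1 out1.
have [q walk_q q0] := hub_graph_walk0 ur vr.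
(* The walk [q] refutes [None]; for [Some k], [k] is the positive weight of [q'] and at most the
   weight 0 of [q]. *)
case: x {out0 out1} dist_u dist_h => [k|] /=; last first.
  by move=> _ /(_ q); rewrite walk_q.
move=> [[q' walk_q' wq'] _] [_ /(_ q walk_q)]; rewrite q0 -wq' leqNgt.
by rewrite (unit_graph_walk_gt0 walk_q' uv).
Qed.

End Adversary.

(** * From little-o bounds to the contradiction *)

Lemma o_max_degree_bound (R : realType) (C : set wgraph) (f : wgraph -> nat)
    (m : nat) : o_max_degree R C f ->
  exists D0, forall G, C G -> D0 <= max_degree G -> m.+1 * f G <= max_degree G.
Proof.
move=> /eqoP /(_ (m.+1%:R^-1)%R); rewrite invr_gt0 ltr0n => /(_ isT).
case=> D0 _ sub; exists D0 => G CG DG.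
have := sub G (conj CG DG); rewrite /= !normr_nat.
by rewrite mulrC ler_pdivlMr ?ltr0n // -natrM ler_nat mulnC.
Qed.

Theorem theorem11 (R : realType) :
  exists c : R, forall A : algorithm,
    ~ exists pre del : wgraph -> nat,
        [/\ (forall G : wgraph, sparse_connected c G ->
               enumerates_apsd (A (nverts G)) (pre G) (del G)),
            o_max_degree R (sparse_connected c) pre &
            o_max_degree R (sparse_connected c) del].
Proof.
exists 3%:R%R => A [pre [del [enumA pre_o del_o]]].
(* The factor 8 suffices: [8 * (pre + del) <= 2 * max_degree <= 8 * t + 4] forces
   [pre + del <= t]. *)
have [D1 pre_small] := o_max_degree_bound 7 pre_o.
have [D2 del_small] := o_max_degree_bound 7 del_o.
(* The maximum degree, at least [4 * t - 1], passes both thresholds. As [n] depends on [t] alone,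
   the machine [A n] is fixed before the graphs are built against it. *)
pose t := (maxn D1 D2).+3; pose n := (4 * t) * (4 * t).
have t_gt2 : 2 < t by [].
have D2n : (4 * t) * (4 * t) <= n by [].
have sparse wt (wt_sym : forall x y, wt x y = wt y x) :
    sparse_connected (3%:R%R : R) (lolli_graph (4 * t)
      (adv_order_uniq t (A n)) (mem_adv_order t (A n)) wt_sym).
  by split; [apply: lolli_connected | apply: lolli_average_degree].
pose G0 := unit_graph t (A n).
have class0 : sparse_connected (3%:R%R : R) G0 := sparse _ _.
have := enumA _ (sparse _ (hub_weight_sym (A n) t_gt2 D2n)).
apply: adversary_wins (enumA G0 class0).
have deg_le : max_degree G0 <= 4 * t + 2 := lolli_max_degree_le _ _ _ _.
have deg_ge : (4 * t).-1 <= max_degree G0.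
  by apply: lolli_max_degree_ge => //; rewrite /n; lia.
have := pre_small G0 class0; have := del_small G0 class0.
by move: deg_le deg_ge; rewrite /t; lia.
Qed.
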